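(* Let $N_f\ge 2$ and let $\bar{\mathcal{G}}_1,\dots,\bar{\mathcal{G}}_{N_f}$ be switched affine fault models such that for all $m,n\in\{1,\dots,N_f\}$ with $m\ne n$ there is a finite positive integer $I_{m,n}$ for which $\bar{\mathcal{G}}_m$ and $\bar{\mathcal{G}}_n$ are $I_{m,n}$-distinguishable. Put $I=\max_{m\ne n} I_{m,n}$. Then, if a (persistent) fault from this set occurs, it can be isolated in at most $I$ steps after its occurrence: for every $i\in\{1,\dots,N_f\}$, every input-output sequence of length $I$ generated by $\bar{\mathcal{G}}_i$, i.e. every element of $\mathcal{B}^{I}_{swa}(\bar{\mathcal{G}}_i)$, is not contained in $\mathcal{B}^{I}_{swa}(\bar{\mathcal{G}}_j)$ for any $j\ne i$. (Such a set of fault models is called $I$-isolable.)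
   Context: SWA model: $\mathcal{G}=(\mathcal{X},\mathcal{E},\mathcal{U},\{G_i\}_{i=1}^m)$, where $\mathcal{X}\subset\mathbb{R}^n$ (states), $\mathcal{E}\subset\mathbb{R}^{n_y+n}$ (measurement noise $\boldsymbol{\eta}\in\mathbb{R}^{n_y}$ stacked with process noise $\boldsymbol{\nu}\in\mathbb{R}^{n}$) and $\mathcal{U}\subset\mathbb{R}^{n_u}$ (inputs) are convex and compact, of the form $\mathcal{X}=\{\mathbf{x}: P\mathbf{x}\le p\}$, $\mathcal{E}=\{\|\boldsymbol{\eta}\|\le\epsilon_\eta,\|\boldsymbol{\nu}\|\le\epsilon_\nu\}$, $\mathcal{U}=\{\|\mathbf{u}\|\le U\}$ (infinity norms), and each mode $G_i=\{\mathbf{A}_i,\mathbf{B}_i,\mathbf{C}_i,\mathbf{D}_i,\mathbf{f}_i,\mathbf{g}_i\}$ consists of real matrices and vectors of compatible dimensions. The evolution is $$\mathbf{x}_{t+1}=\mathbf{A}_{\sigma_t}\mathbf{x}_t+\mathbf{B}_{\sigma_t}\mathbf{u}_t+\mathbf{f}_{\sigma_t}+\boldsymbol{\nu}_t,\qquad \mathbf{y}_t=\mathbf{C}_{\sigma_t}\mathbf{x}_t+\mathbf{D}_{\sigma_t}\mathbf{u}_t+\mathbf{g}_{\sigma_t}+\boldsymbol{\eta}_t,$$ with active mode $\sigma_t\in\{1,\dots,m\}$. A fault model for an SWA system $\mathcal{G}$ is another SWA model with the same numbers of states, inputs and outputs (its admissible sets, number of modes and modes may differ). Length-$N$ behavior: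 $\mathcal{B}^N_{swa}(\mathcal{G})$ is the set of all sequences $\{\mathbf{u}_t,\mathbf{y}_t\}_{t=0}^{N-1}$ with $\mathbf{u}_t\in\mathcal{U}$ for which there exist $\mathbf{x}_t\in\mathcal{X}$, $\sigma_t\in\{1,\dots,m\}$, $[\boldsymbol{\eta}_t^\intercal\ \boldsymbol{\nu}_t^\intercal]^\intercal\in\mathcal{E}$ for $t=0,\dots,N-1$ such that the evolution equations hold for $t=0,\dots,N-1$ (the state $\mathbf{x}_N$ is any vector of $\mathbb{R}^n$, not required to lie in $\mathcal{X}$). $T$-distinguishability: two SWA models $\mathcal{G},\bar{\mathcal{G}}$ are $T$-distinguishable ($T$ a positive integer) if $\mathcal{B}^T_{swa}(\mathcal{G})\cap\mathcal{B}^T_{swa}(\bar{\mathcal{G}})=\emptyset$. Isolation: a fault is isolated when the input-output data generated since its occurrence are incompatible with (not in the behavior of) every other fault model in the set. A fault is persistent if, once it occurs, the data are generated by its fault model from then on. *)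

(* Defs.v *)
(* MathComp / MathComp-Analysis. *)
From HB Require Import structures.
From mathcomp Require Import all_boot all_order all_algebra.
From mathcomp Require Import all_classical all_reals all_analysis.

Set Implicit Arguments.
Unset Strict Implicit.
Unset Printing Implicit Defensive.

Import Order.TTheory GRing.Theory Num.Theory.
Import numFieldNormedType.Exports.

Local Open Scope classical_set_scope.
Local Open Scope ring_scope.

Record mode (R : realType) (n n_u n_y : nat) := Mode {
  mode_A : 'M[R]_(n, n);
  mode_B : 'M[R]_(n, n_u);
  mode_C : 'M[R]_(n_y, n);
  mode_D : 'M[R]_(n_y, n_u);
  mode_f : 'cV[R]_n;
  mode_g : 'cV[R]_n_y }.

Definition polyhedron (R : realType) (k n : nat) (P : 'M[R]_(k, n))
    (p : 'cV[R]_k) : set 'cV[R]_n :=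
  [set x | forall r : 'I_k, (P *m x) r 0 <= p r 0].

(* Only the compactness of the state set is assumed: polyhedra and sup-norm
   balls are convex, and the balls are compact. *)
Record swa (R : realType) (n n_u n_y : nat) := Swa {
  swa_k : nat;
  swa_P : 'M[R]_(swa_k, n);
  swa_p : 'cV[R]_swa_k;
  swa_compact : compact (polyhedron swa_P swa_p);
  swa_eps_eta : R;
  swa_eps_nu : R;
  swa_U : R;
  swa_m : nat;
  swa_mode : 'I_swa_m -> mode R n n_u n_y }.

Section Behavior.
Variables (R : realType) (n n_u n_y : nat).
Implicit Types (G : swa R n n_u n_y).

Definition state_set G : set 'cV[R]_n := polyhedron (swa_P G) (swa_p G).

(* The norm `|_| on matrices is the maximum of the absolute values of the
   entries, i.e. the infinity norm on column vectors. *)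
Definition noise_set G : set 'cV[R]_(n_y + n) :=
  [set e | `|usubmx e| <= swa_eps_eta G /\ `|dsubmx e| <= swa_eps_nu G].

Definition input_set G : set 'cV[R]_n_u := [set u | `|u| <= swa_U G].

Definition io_seq (N : nat) := 'I_N -> 'cV[R]_n_u * 'cV[R]_n_y.

(* Only the values x 0, ..., x N matter, and x N need not be in state_set G. *)
Definition behavior (N : nat) G : set (io_seq N) :=
  [set w | (forall t, input_set G (w t).1) /\
    exists (x : nat -> 'cV[R]_n) (sigma : 'I_N -> 'I_(swa_m G))
           (eta : 'I_N -> 'cV[R]_n_y) (nu : 'I_N -> 'cV[R]_n),
      forall t : 'I_N,
        let M := swa_mode (sigma t) in
        [/\ state_set G (x t),
            noise_set G (col_mx (eta t) (nu t)),
            x t.+1 = mode_A M *m x t + mode_B M *m (w t).1 + mode_f M + nu t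
          & (w t).2 = mode_C M *m x t + mode_D M *m (w t).1 + mode_g M
                      + eta t]].

Arguments behavior N G _ : clear implicits.

Definition distinguishable (T : nat) (G G' : swa R n n_u n_y) : Prop :=
  behavior T G `&` behavior T G' = set0.

Variables (Nf : nat) (G : 'I_Nf -> swa R n n_u n_y).

(* The data w, collected since the occurrence of fault i, isolate it. *)
Definition fault_isolated (T : nat) (i : 'I_Nf) (w : io_seq T) : Prop :=
  forall j, j != i -> ~ behavior T (G j) w.

(* Fault i being persistent, the data of the T steps following its occurrence
   form an arbitrary element of behavior T (G i). *)
Definition isolable (T : nat) : Prop :=
  forall i (w : io_seq T), behavior T (G i) w -> fault_isolated i w.

End Behavior.
Arguments behavior {R n n_u n_y} N G _.

(* Main.v *)
(** A prefix of an input-output behavior is a behavior of the same model, and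
    the terminal state of the prefix is merely less constrained than in the
    full run. Hence distinguishability is monotone in the horizon, and every
    pair of fault models is already distinguishable at the maximal horizon. *)
Require Import Defs.
From mathcomp Require Import all_boot all_order all_algebra.
From mathcomp Require Import all_classical all_reals all_analysis.

Lemma behavior_prefix (R : realType) (n n_u n_y T N : nat) (leTN : T <= N)
    (G : swa R n n_u n_y) (w : io_seq R n_u n_y N) :
  behavior N G w -> behavior T G (w \o widen_ord leTN).
Proof.
move=> [wU [x [sigma [eta [nu run]]]]]; split=> [t|]; first exact: wU.
(* [x] is indexed by [nat], so it needs no restriction. As [widen_ord] keeps the underlying number,
   the equations at [t] are by conversion those of the long run. *)
exists x, (sigma \o widen_ord leTN), (eta \o widen_ord leTN),
  (nu \o widen_ord leTN) => t.
exact: run (widen_ord leTN t).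
Qed.

(** A sequence common to both models at horizon [N] would have a common prefix at horizon [T]. *)
Lemma distinguishable_leq (R : realType) (n n_u n_y T N : nat)
    (G G' : swa R n n_u n_y) :
  T <= N -> distinguishable T G G' -> distinguishable N G G'.
Proof.
move=> leTN; rewrite /distinguishable -!subset0 => disj w [wG wG'].
by apply: (disj (w \o widen_ord leTN)); split; apply: behavior_prefix.
Qed.

Theorem proposition2 (R : realType) (n n_u n_y Nf : nat) (hNf : 2 <= Nf)
    (G : 'I_Nf -> swa R n n_u n_y) (I : 'I_Nf -> 'I_Nf -> nat)
    (hI : forall i j : 'I_Nf, i != j ->
            0 < I i j /\ distinguishable (I i j) (G i) (G j)) :
  isolable G (\max_(ij : 'I_Nf * 'I_Nf | ij.1 != ij.2) I ij.1 ij.2).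
Proof.
move=> i w wGi j neq_ji wGj.
have neq_ij : i != j by rewrite eq_sym.
have [_ disj] := hI i j neq_ij.
have leI : I i j <= \max_(ij : 'I_Nf * 'I_Nf | ij.1 != ij.2) I ij.1 ij.2.
  (* By [neq_ij] the pair [(i, j)] is in the range of the maximum and can be split off. *)
  by rewrite (bigD1 (i, j)) //= leq_maxl.
have := distinguishable_leq _ _ _ _ _ _ _ _ leI disj.
by rewrite /distinguishable -subset0 => /(_ w); apply; split.
Qed.
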